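(* There is an absolute constant $c>0$ such that for every $\phi\ge1$ there exists a $\phi$-smooth instance $\mathcal{I}$ of scheduling on unrestricted related machines such that every instance $I$ in its support (i.e., for every realization of the processing requirements) satisfies \[ \max_{\sigma\in\mathrm{Lex}(I)}\frac{C_{\max}(I,\sigma)}{C^*_{\max}(I)}\ge c\log\phi \quad\text{and}\quad \max_{\sigma\in\mathrm{List}(I)}\frac{C_{\max}(I,\sigma)}{C^*_{\max}(I)}\ge c\log\phi . \]
   Context: Scheduling on unrestricted related machines: machines $M=\{1,\dots,m\}$ with speeds $s_1\ge\dots\ge s_m=1$, jobs $J=\{1,\dots,n\}$ with processing requirements $p_j\ge0$; job $j$ on machine $i$ takes time $p_j/s_i$. A schedule $\sigma$ assigns each job to a machine; $J_i(\sigma)$ is the set of jobs on $i$, $L_i(\sigma)=\sum_{j\in J_i(\sigma)}p_j/s_i$, $C_{\max}(I,\sigma)=\max_iL_i(\sigma)$, $C^*_{\max}(I)$ is the minimum makespan. $\sigma$ is lex-jump optimal if for every machine $i$, every job $j\in J_i(\sigma)$ and every $i'\ne i$: $L_{i'}(\sigma)+p_j/s_{i'}\ge L_i(\sigma)$; $\mathrm{Lex}(I)$ is the set of such schedules. List scheduling takes an ordering of the jobs and assigns them one by one in this order, each to a machine $i$ minimizing (current load of $i$) $+\,p_j/s_i$, ties broken arbitrarily; $\mathrm{List}(I)$ is the set of all schedules so obtainable. A $\phi$-smooth instance consists of a choice of $m$, speeds $s_1\ge\dots\ge s_m=1$, $n$, and for each job $j$ a density $f_j:[0,1]\to[0,\phi]$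 according to which $p_j$ is drawn independently (equivalently, since ratios are scale invariant, densities on $[0,B]$ bounded by $\phi/B$ for a common $B>0$). (The paper states the result as an $\Omega(\log\phi)$ lower bound holding for any realization.) *)

(* Defs.v *)
From mathcomp Require Import all_boot all_order all_algebra all_fingroup.
From mathcomp Require Import all_classical all_reals all_analysis.

Set Implicit Arguments.
Unset Strict Implicit.
Unset Printing Implicit Defensive.

Import Order.TTheory GRing.Theory Num.Theory.
Import numFieldNormedType.Exports.

Local Open Scope classical_set_scope.
Local Open Scope ring_scope.

(* Machines are indexed by 'I_m.+1, so that there is always at least one (the
   slowest machine, of speed 1, is ord_max); jobs are indexed by 'I_n. *)
Section Scheduling.
Variables (R : realType) (m n : nat).
Variables (s : 'I_m.+1 -> R) (p : 'I_n -> R).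

Definition schedule := {ffun 'I_n -> 'I_m.+1}.

Implicit Types (sigma : schedule) (i : 'I_m.+1) (j : 'I_n).

Definition load sigma i : R := \sum_(j | sigma j == i) p j / s i.

(* The value 0 of an empty maximum is harmless: loads are nonnegative. *)
Definition Cmax sigma : R := \big[Num.max/0]_i load sigma i.

(* The initial value is itself the makespan of a schedule, so this is the
   minimum over all schedules. *)
Definition Copt : R :=
  \big[Num.min/Cmax [ffun=> ord0]]_(sigma : schedule) Cmax sigma.

Definition lex_jump_optimal : pred schedule := fun sigma =>
  [forall i, forall j, (sigma j == i) ==>
    [forall i', (i' != i) ==> (load sigma i <= load sigma i' + p j / s i')]].

(* Load of machine i just before the job in position k of the ordering o
   (whose l-th job is o l) is assigned. *)
Definition load_before (o : {perm 'I_n}) sigma (k : 'I_n) i : R :=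
  \sum_(l < n | (l < k)%N && (sigma (o l) == i)) p (o l) / s i.

(* Leaving the choice among the minimizing machines free accounts for the
   arbitrary tie breaking. *)
Definition list_schedule : pred schedule := fun sigma =>
  [exists o : {perm 'I_n}, forall k : 'I_n, forall i,
     load_before o sigma k (sigma (o k)) + p (o k) / s (sigma (o k))
       <= load_before o sigma k i + p (o k) / s i].

(* When Copt = 0, that is when all p j are 0, the ratio is 0 by the
   convention x / 0 = 0. *)
Definition worst_ratio (P : pred schedule) : R :=
  \big[Num.max/0]_(sigma : schedule | P sigma) (Cmax sigma / Copt).

End Scheduling.

Record smooth_instance (R : realType) (phi : R) := SmoothInstance {
  nmach : nat; (* number of machines minus one *)
  njobs : nat;
  speed : 'I_nmach.+1 -> R;
  density : 'I_njobs -> R -> R; (* only the values on [0, 1] matter *)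
  speed_noninc : forall i i' : 'I_nmach.+1, (i <= i')%N -> speed i' <= speed i;
  speed_last : speed ord_max = 1;
  density_measurable : forall j, measurable_fun `[0 : R, 1 : R] (density j);
  density_bounded : forall j x, 0 <= x <= 1 -> 0 <= density j x <= phi;
  density_integral : forall j,
    (\int[@lebesgue_measure R]_(x in `[0%R, 1%R]) (density j x)%:E = 1)%E
}.

Arguments speed {R phi} I i : rename.
Arguments density {R phi} I j x : rename.

Section Realizations.
Variables (R : realType) (phi : R) (I : smooth_instance phi).

(* Probability that the j-th processing requirement lies in A. *)
Definition law (j : 'I_(njobs I)) (A : set R) : \bar R :=
  (\int[@lebesgue_measure R]_(x in `[0%R, 1%R] `&` A) (density I j x)%:E)%E.

(* Probability that the j-th requirement lies in A j for all j: by independence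
   it is the product of the marginal probabilities. *)
Definition box_prob (A : 'I_(njobs I) -> set R) : R :=
  \prod_j fine (law j (A j)).

(* Topological support of the joint law: open boxes form a base of the topology
   of R^n. *)
Definition in_support (p : 'I_(njobs I) -> R) : Prop :=
  forall U : 'I_(njobs I) -> set R,
    (forall j, open (U j)) -> (forall j, U j (p j)) -> 0 < box_prob U.

End Realizations.

(* Main.v *)
(** Machines come in classes [0, ..., K], those of class [k] having speed
    [2 ^ k], and every machine of class [k] is assigned exactly [k] jobs of
    size about [2 ^ k * U].  It thus has load about [k * U], and no job wants to
    move to class [k' < k], since there it would finish at about
    [(k' + 2 ^ (k - k')) * U >= (k + 1) * U].  As there are at least [K] times as
    many machines of class at least [k - 1] as of class at least [k], spreading
    the jobs one per machine, at most one class lower, has makespan at most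
    [3 * U].  With [U = 8 ^ K / phi], the noise of width [1 / phi] allowed by
    the density bound is too small to invalidate any of these comparisons, and
    the largest size is below [1] as soon as [32 ^ K <= phi].  The same schedule
    is a list schedule: assign the first job of every machine, then the second
    job, and so on, each round going from fast to slow machines and, within a
    class, by increasing load; only this ordering depends on the realization. *)
Require Import Defs.
From mathcomp Require Import all_boot all_order all_algebra all_fingroup.
From mathcomp Require Import all_classical all_reals all_analysis.
From mathcomp Require Import measurable_realfun.
From mathcomp Require Import lra zify.

Set Implicit Arguments.
Unset Strict Implicit.
Unset Printing Implicit Defensive.

Import Order.TTheory GRing.Theory Num.Theory.
Import numFieldNormedType.Exports.

Local Open Scope classical_set_scope.
Local Open Scope ring_scope.

(** * Sums, sorting and elementary makespan bounds *)

Lemma sum_sub_le (R : realType) (T : finType) (P Q : pred T) (F : T -> R) :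
  (forall x, 0 <= F x) -> (forall x, P x -> Q x) ->
  \sum_(x | P x) F x <= \sum_(x | Q x) F x.
Proof.
move=> F0 PQ; rewrite big_mkcond [leRHS]big_mkcond; apply: ler_sum => x _.
by case: ifP => [/PQ -> //|_]; case: ifP.
Qed.

Lemma sorting_perm (R : realType) (n : nat) (key : 'I_n -> R) :
  exists o : {perm 'I_n}, forall k l : 'I_n, (k <= l)%N -> key (o k) <= key (o l).
Proof.
pose leK := relpre key <=%R.
have leK_total : total leK by move=> x y; exact: le_total.
have leK_trans : transitive leK by move=> y x z; exact: le_trans.
have /tuple_permP[ord so] : perm_eq (sort leK (ord_tuple n)) (ord_tuple n).
  by rewrite perm_sort.
exists ord => k l kl.
have nthE (i : 'I_n) : nth k (sort leK (ord_tuple n)) i = ord i.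
  by rewrite so -tnth_nth tnth_mktuple tnth_ord_tuple.
have := sort_sorted leK_total (ord_tuple n).
have size_s : size (sort leK (ord_tuple n)) = n by rewrite size_sort size_tuple.
move=> /(sorted_leq_nth leK_trans (fun x => lexx (key x)) k) /(_ k l).
by rewrite !inE size_s !ltn_ord !nthE; apply.
Qed.

Section Generalities.
Variables (R : realType) (m n : nat).
Variables (s : 'I_m.+1 -> R) (p : 'I_n -> R).

Lemma worst_ratio_ge (P : pred (schedule m n)) sigma (x : R) :
  P sigma -> x <= Cmax s p sigma / Copt s p -> x <= worst_ratio s p P.
Proof. by move=> Ps /le_trans; apply; exact: le_bigmax_cond. Qed.

Lemma worst_ratio_ge0 (P : pred (schedule m n)) : 0 <= worst_ratio s p P.
Proof. exact: bigmax_ge_id. Qed.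

Lemma load_le_Cmax (sigma : schedule m n) i : load s p sigma i <= Cmax s p sigma.
Proof. exact: le_bigmax. Qed.

Lemma Copt_le_Cmax (sigma : schedule m n) : Copt s p <= Cmax s p sigma.
Proof. exact: bigmin_le. Qed.

Lemma Cmax_le (sigma : schedule m n) x :
  0 <= x -> (forall i, load s p sigma i <= x) -> Cmax s p sigma <= x.
Proof. by move=> x0 lx; apply: bigmax_le. Qed.

Lemma Copt_gt0 j : (forall i, 0 < s i) -> (forall j', 0 <= p j') -> 0 < p j ->
  0 < Copt s p.
Proof.
move=> s0 p0 pj0.
have C0 (sigma : schedule m n) : 0 < Cmax s p sigma.
  apply: lt_le_trans (load_le_Cmax sigma (sigma j)).
  rewrite /load (bigD1 j) //= ltr_pwDl ?divr_gt0 // sumr_ge0 // => l _.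
  by rewrite divr_ge0 // ltW.
by apply: lt_bigmin => *; exact: C0.
Qed.

(** Indexing by jobs instead of positions lets these loads be compared with other sums over jobs by
    inclusion of index sets. *)
Lemma load_beforeE (o : {perm 'I_n}) (sigma : schedule m n) k i :
  load_before s p o sigma k i =
  \sum_(j | ((o^-1)%g j < k)%N && (sigma j == i)) p j / s i.
Proof.
rewrite /load_before [RHS](reindex_inj (@perm_inj _ o)) /=.
by apply: eq_bigl => l; rewrite permK.
Qed.

End Generalities.

(** * The layered schedule under bounded noise *)

Section LayeredSchedule.
Variables (R : realType) (m n K : nat).
Variables (cls : 'I_m.+1 -> nat) (mch : 'I_n -> 'I_m.+1) (rnd : 'I_n -> nat).
(** [d] bounds the noise of one size, [e] the noise accumulated in the load of a machine, which has
    at most [K] jobs. *)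
Variables (U d e : R) (p : 'I_n -> R).
Hypothesis cls_le : forall i, (cls i <= K)%N.
Hypothesis rnd_lt : forall j, (rnd j < cls (mch j))%N.
Hypothesis mch_rnd_inj : forall j l, mch j = mch l -> rnd j = rnd l -> j = l.
Hypothesis mch_rnd_surj :
  forall i r, (r < cls i)%N -> exists2 j, mch j = i & rnd j = r.
Hypothesis p_bounds :
  forall j, 2 ^+ cls (mch j) * U <= p j <= 2 ^+ cls (mch j) * U + d.
Hypothesis d_gt0 : 0 < d.
Hypothesis Kd_le : K%:R * d <= e.
Hypothesis e_gt0 : 0 < e.
(** The sorting key below discounts a start time by at most [2 * K * e]; with a further [e] of noise
    this must stay below [U], the length of a round. *)
Hypothesis e_small : (2 * K%:R + 1) * e < U.
Hypothesis e_le : 2 ^+ K * e <= U.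

Let s i : R := 2 ^+ cls i.
Let sigma : schedule m n := [ffun j => mch j].

Let s_gt0 i : 0 < s i. Proof. by rewrite exprn_gt0. Qed.

Let U_gt0 : 0 < U.
Proof. by apply: lt_le_trans e_le; rewrite mulr_gt0 ?exprn_gt0. Qed.

Let p_gt0 j : 0 < p j.
Proof.
have /andP[+ _] := p_bounds j; apply: lt_le_trans.
by rewrite mulr_gt0 ?exprn_gt0.
Qed.

Let time_ge0 j i : 0 <= p j / s i.
Proof. by rewrite divr_ge0 // ltW. Qed.

Let time_own j : U <= p j / s (mch j) <= U + d.
Proof.
have /andP[lo hi] := p_bounds j.
rewrite ler_pdivlMr // mulrC lo ler_pdivrMr //= (le_trans hi) //.
have : 1 * d <= s (mch j) * d by rewrite ler_pM2r // exprn_ege1 // ler1n.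
by rewrite /s; lra.
Qed.

Let time_slower j i : (cls i <= cls (mch j))%N ->
  2 ^+ (cls (mch j) - cls i) * U <= p j / s i.
Proof.
move=> le_cls; rewrite ler_pdivlMr // mulrAC -exprD subnK //.
by have /andP[] := p_bounds j.
Qed.

(** By [e_le], even the fastest machine needs time [e] for a size of at least [U], so one extra job
    always outweighs the accumulated noise. *)
Let time_any j i : e <= p j / s i.
Proof.
have /andP[lo _] := p_bounds j.
rewrite ler_pdivlMr // (le_trans _ lo) // (le_trans (y := U)) //.
  apply: le_trans e_le; rewrite mulrC ler_pM2r //.
  by rewrite ler_weXn2l ?ler1n.
by apply: ler_peMl; [exact: ltW | rewrite exprn_ege1 // ler1n].
Qed.

(** The time at which machine [i] begins its job of round [r], or its full load when [r] is its
    class. *)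
Let start i r : R := \sum_(j | (mch j == i) && (rnd j < r)%N) p j / s i.

Let startS i r j : mch j = i -> rnd j = r ->
  start i r.+1 = start i r + p j / s i.
Proof.
move=> mj rj; rewrite /start (bigD1 j) /=; last by rewrite mj rj eqxx ltnSn.
rewrite addrC; congr (_ + _); apply: eq_bigl => l.
rewrite ltnS leq_eqVlt; case: (eqVneq (mch l) i) => //= ml.
case: (eqVneq l j) => [->|lj] /=; first by rewrite andbF rj ltnn.
rewrite andbT; case: eqP => //= rl.
by case/eqP: lj; apply: mch_rnd_inj; rewrite ?mj ?rj.
Qed.

Let start_bounds i r : (r <= cls i)%N ->
  r%:R * U <= start i r <= r%:R * U + r%:R * d.
Proof.
elim: r => [_|r IH ri].
  by rewrite /start big_pred0 => [|j]; rewrite ?andbF // !mul0r addr0 lexx.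
have [j mj rj] := mch_rnd_surj ri.
rewrite (startS mj rj) -natr1.
have := IH (ltnW ri); have := time_own j; rewrite mj; lra.
Qed.

Let noise_le r : (r <= K)%N -> r%:R * d <= e.
Proof.
by move=> rK; apply: le_trans Kd_le; rewrite ler_pM2r // ler_nat.
Qed.

Let loadE i : load s p sigma i = start i (cls i).
Proof.
rewrite /load /start; apply: eq_bigl => j; rewrite ffunE.
by case: eqP => //= <-; rewrite rnd_lt.
Qed.

Let load_bounds i : (cls i)%:R * U <= load s p sigma i <= (cls i)%:R * U + e.
Proof.
rewrite loadE; have /andP[-> hi] := start_bounds (leqnn (cls i)).
by rewrite (le_trans hi) // lerD2l noise_le.
Qed.

Let e_lt_U : e < U.
Proof.
apply: le_lt_trans e_small; apply: ler_peMl; first exact: ltW.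
have := ler0n R K; lra.
Qed.

(* On a slower machine a job waits less but runs longer: [2 ^ t >= t + 1]. *)
Let finish_slower (x : R) r j i :
  (r <= cls i <= cls (mch j))%N -> r%:R * U <= x ->
  (r + (cls (mch j) - cls i).+1)%:R * U <= x + p j / s i.
Proof.
move=> /andP[ri ij] xr; have := time_slower ij.
set t := (_ - _)%N => ht.
have : t.+1%:R * U <= 2 ^+ t * U.
  by rewrite ler_pM2r // -natrX ler_nat ltn_expl.
rewrite natrD mulrDl; lra.
Qed.

Lemma layered_lex_jump_optimal : lex_jump_optimal s p sigma.
Proof.
apply/forallP => i; apply/forallP => j; apply/implyP; rewrite ffunE => /eqP mj.
apply/forallP => i'; apply/implyP => _.
have /andP[lo _] := load_bounds i'; have /andP[_ hi] := load_bounds i.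
have [le_cls|lt_cls] := leqP (cls i') (cls i).
  have := @finish_slower (load s p sigma i') (cls i') j i'.
  rewrite mj le_cls leqnn => /(_ isT lo).
  rewrite addnS subnKC // -natr1; have := e_lt_U; lra.
(* A faster machine carries at least one more job, so its load alone suffices. *)
have : (cls i).+1%:R * U <= (cls i')%:R * U by rewrite ler_pM2r // ler_nat.
rewrite -natr1; have := time_ge0 j i'; have := e_lt_U; lra.
Qed.

(* Start times in a round vary by at most [e], so this orders the jobs by
   round, then by decreasing speed, then by start time. *)
Let key j : R := start (mch j) (rnd j) - 2 * e * (cls (mch j))%:R.

Let key_bounds j :
  (rnd j)%:R * U <= key j + 2 * e * (cls (mch j))%:R <= (rnd j)%:R * U + e.
Proof.
rewrite /key subrK; have /andP[-> hi] := start_bounds (ltnW (rnd_lt j)).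
rewrite (le_trans hi) // lerD2l noise_le //.
by rewrite (leq_trans _ (cls_le (mch j))) // ltnW.
Qed.

Let key_lt_rnd j l : (rnd j < rnd l)%N -> key j < key l.
Proof.
move=> jl; have := key_bounds j; have := key_bounds l.
have : (rnd j).+1%:R * U <= (rnd l)%:R * U by rewrite ler_pM2r // ler_nat.
rewrite -[(rnd j).+1%:R]natr1.
have : e * (cls (mch l))%:R <= e * K%:R by rewrite ler_pM2l // ler_nat.
have : 0 <= e * (cls (mch j))%:R by rewrite mulr_ge0 // ltW.
have := e_small; lra.
Qed.

Let key_lt_cls j l : rnd j = rnd l -> (cls (mch l) < cls (mch j))%N ->
  key j < key l.
Proof.
move=> jl lt_cls; have := key_bounds j; have := key_bounds l; rewrite jl.
have : e * (cls (mch l)).+1%:R <= e * (cls (mch j))%:R.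
  by rewrite ler_pM2l // ler_nat.
rewrite -[(cls _).+1%:R]natr1; have := e_gt0; lra.
Qed.

Lemma layered_list_schedule : list_schedule s p sigma.
Proof.
have [ord key_ord] := sorting_perm key.
have before j l : key j < key l -> ((ord^-1)%g j < (ord^-1)%g l)%N.
  move=> jl; rewrite ltnNge; apply: contraTN jl => /key_ord.
  by rewrite !permKV leNgt.
apply/existsP; exists ord; apply/forallP => k; apply/forallP => i.
rewrite !load_beforeE ffunE; set j := ord k.
have kE : k = (ord^-1)%g j by rewrite permK.
set W := fun i' => \sum_(l | ((ord^-1)%g l < k)%N && (sigma l == i')) p l / s i'.
rewrite -!/(W _).
have W_ge r : (forall l, mch l = i -> (rnd l < r)%N -> key l < key j) ->
    start i r <= W i.
  move=> kl; apply: sum_sub_le => // l /andP[/eqP ml rl].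
  by rewrite ffunE ml eqxx andbT kE before // kl.
have W_own : W (mch j) <= start (mch j) (rnd j).
  apply: sum_sub_le => // l /andP[lk]; rewrite ffunE => /eqP ml.
  rewrite ml eqxx /= ltnNge; apply: contraTN lk; rewrite kE -leqNgt.
  rewrite leq_eqVlt => /orP[/eqP jl|jl]; first by rewrite (@mch_rnd_inj l j).
  by rewrite ltnW // before // key_lt_rnd.
have /andP[_ own_hi] := time_own j.
have rj := rnd_lt j; have jK := leq_trans rj (cls_le (mch j)).
have /andP[_ start_hi] := start_bounds (ltnW rj).
have finish_hi : W (mch j) + p j / s (mch j) <= (rnd j).+1%:R * U + e.
  by have := noise_le jK; rewrite -natr1; lra.
have finish_lo r : (r <= cls i)%N -> (r <= rnd j)%N -> r%:R * U <= W i.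
  move=> ri rrj; have /andP[lo _] := start_bounds ri; apply: le_trans lo _.
  by apply: W_ge => l _ /leq_trans /(_ rrj); exact: key_lt_rnd.
(* If [i] has no job in this round, it is slower than the machine of [j] and already fully loaded,
   so [j] would finish there no earlier than [(rnd j + 2) * U]. *)
have [ir|ri] := leqP (cls i) (rnd j).
  have ij := leq_trans ir (ltnW rj).
  have := @finish_slower (W i) (cls i) j i.
  rewrite leqnn ij => /(_ isT (finish_lo _ (leqnn _) ir)).
  rewrite addnS subnKC //.
  have : (rnd j).+2%:R * U <= (cls (mch j)).+1%:R * U.
    by rewrite ler_pM2r // ler_nat.
  by rewrite -[(rnd j).+2%:R]natr1; have := e_lt_U; lra.
have W_next : (forall l, mch l = i -> rnd l = rnd j -> key l < key j) ->
    (rnd j).+1%:R * U <= W i.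
  move=> kl; have /andP[lo _] := start_bounds ri; apply: le_trans lo _.
  apply: W_ge => l ml; rewrite ltnS leq_eqVlt => /orP[/eqP|]; first exact: kl.
  exact: key_lt_rnd.
(* A faster machine already has its job of this round, and [j] would add at least [e]. On a slower
   one [j] would finish no earlier than [(rnd j + 2) * U]. *)
have [lt_cls|lt_cls|eq_cls] := ltngtP (cls (mch j)) (cls i).
- have : (rnd j).+1%:R * U <= W i.
    by apply: W_next => l ml rl; apply: key_lt_cls; rewrite ?ml.
  have := time_any j i; lra.
- have := @finish_slower (W i) (rnd j) j i.
  rewrite (ltnW ri) (ltnW lt_cls) => /(_ isT (finish_lo _ (ltnW ri) (leqnn _))).
  have : (rnd j).+2%:R * U <= (rnd j + (cls (mch j) - cls i).+1)%:R * U.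
    by rewrite ler_pM2r // ler_nat -addn2 leq_add2l ltnS subn_gt0.
  by rewrite -[(rnd j).+2%:R]natr1; have := e_lt_U; lra.
have sE : s i = s (mch j) by rewrite /s eq_cls.
have [l ml rl] := mch_rnd_surj ri.
(* Within a class, either [i] already has its job of this round, or it begins the round no earlier
   than the machine of [j] and runs [j] equally fast. *)
have [lj|jl] := ltP (key l) (key j).
  have : (rnd j).+1%:R * U <= W i.
    apply: W_next => l' ml' rl'; suff -> : l' = l by [].
    by apply: mch_rnd_inj; rewrite ?ml ?rl.
  have := time_any j i; lra.
rewrite sE lerD2r (le_trans W_own) //.
have : start i (rnd j) <= W i by apply: W_ge => ? _; exact: key_lt_rnd.
apply: le_trans; move: jl; rewrite /key ml rl eq_cls; lra.
Qed.

(** Under [tau] a machine has at most one job, which takes at most [2 * U] plus noise [d <= U]; this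
    is the source of the factor 3. *)
Lemma layered_ratio tau i0 :
  injective tau -> (forall j, (cls (mch j) <= (cls (tau j)).+1)%N) ->
  cls i0 = K -> (0 < K)%N -> K%:R / 3 <= Cmax s p sigma / Copt s p.
Proof.
move=> tau_inj tau_cls i0K K_gt0.
have [j0 _ _] : exists2 j, mch j = i0 & rnd j = 0%N.
  by apply: mch_rnd_surj; rewrite i0K.
have Copt0 : 0 < Copt s p by apply: (@Copt_gt0 _ _ _ _ _ j0) => // j; exact: ltW.
have CmaxK : K%:R * U <= Cmax s p sigma.
  have /andP[+ _] := load_bounds i0; rewrite i0K => /le_trans; apply.
  exact: load_le_Cmax.
have d_le : d <= U.
  have : 1 * d <= K%:R * d by rewrite ler_pM2r // ler1n.
  have := e_lt_U; have := Kd_le; lra.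
have Copt3 : Copt s p <= 3 * U.
  apply: le_trans (Copt_le_Cmax s p [ffun j => tau j]) _.
  apply: Cmax_le => [|i]; first by rewrite mulr_ge0 ?ltW.
  rewrite /load.
  case: (pickP (fun j => tau j == i)) => [j /eqP ji|no_job]; last first.
    by rewrite big_pred0 => [|j]; rewrite ?ffunE // mulr_ge0 // ltW.
  rewrite (bigD1 j) ?ffunE ?ji //= big1 => [|l].
    rewrite addr0 ler_pdivrMr //; have /andP[_ /le_trans] := p_bounds j; apply.
    have : 2 ^+ cls (mch j) * U <= 2 ^+ (cls i).+1 * U.
      by rewrite ler_pM2r // ler_weXn2l ?ler1n // -ji tau_cls.
    have : 1 * U <= s i * U by rewrite ler_pM2r // exprn_ege1 // ler1n.
    rewrite exprS /s; lra.
  rewrite ffunE => /andP[/eqP li /eqP[]]; apply: tau_inj.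
  by rewrite li ji.
rewrite ler_pdivlMr //.
have K0 : 0 <= K%:R / 3 :> R by rewrite divr_ge0.
have := ler_wpM2l K0 Copt3; move: CmaxK; lra.
Qed.

End LayeredSchedule.

(** * Sizes uniform on intervals of length [1 / phi] *)

Section UniformInstance.
Variables (R : realType) (phi : R) (m n : nat).
Variables (s : 'I_m.+1 -> R) (a : 'I_n -> R).
Hypothesis phi_gt0 : 0 < phi.
Hypothesis s_noninc : forall i i' : 'I_m.+1, (i <= i')%N -> s i' <= s i.
Hypothesis s_last : s ord_max = 1.
Hypothesis a_range : forall j, 0 <= a j <= 1 - phi^-1.

Let noise j : set R := `[a j, a j + phi^-1].

Definition uniform_density j (x : R) : R := phi * \1_(noise j) x.

Let measurable_noise j : measurable (noise j).
Proof. exact: measurable_itv. Qed.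

Lemma uniform_density_measurable j :
  measurable_fun `[0 : R, 1 : R] (uniform_density j).
Proof.
by apply: measurable_funM; [exact: measurable_cst | exact: measurable_indic].
Qed.

Lemma uniform_density_bounded j x :
  0 <= x <= 1 -> 0 <= uniform_density j x <= phi.
Proof.
move=> _; rewrite /uniform_density indicE; case: (_ \in _).
  by rewrite mulr1 lexx ltW.
by rewrite mulr0 lexx ltW.
Qed.

Lemma integral_uniform_density j (D : set R) : measurable D ->
  (\int[@lebesgue_measure R]_(x in D) (uniform_density j x)%:E =
   phi%:E * @lebesgue_measure R (noise j `&` D))%E.
Proof.
move=> mD; rewrite -integral_indic //; last exact: measurable_noise.
apply: (@integralZl_indic _ _ _ (@lebesgue_measure R) _ mD
  (fun=> noise j) phi) => [phi_lt0|];
  last exact: measurable_noise.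
by have := lt_trans phi_gt0 phi_lt0; rewrite ltxx.
Qed.

Lemma uniform_density_integral j :
  (\int[@lebesgue_measure R]_(x in `[0%R, 1%R]) (uniform_density j x)%:E = 1)%E.
Proof.
rewrite integral_uniform_density; last exact: measurable_itv.
rewrite setIidl; last first.
  move=> x; rewrite /noise /= !in_itv /=; have := a_range j; lra.
have phiV : 0 < phi^-1 by rewrite invr_gt0.
rewrite lebesgue_measure_itv /= lte_fin ltrDl phiV -EFinB addrAC subrr add0r.
by rewrite -EFinM divff // gt_eqF.
Qed.

Definition uniform_instance : smooth_instance phi :=
  SmoothInstance s_noninc s_last uniform_density_measurable
    uniform_density_bounded uniform_density_integral.

(** The complement of the closed interval [noise j] is open and has probability 0. If it contained
    [p j], the box with this side at [j] and the whole line elsewhere would contradict the support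
    condition. *)
Lemma uniform_support (p : 'I_n -> R) :
  in_support (I := uniform_instance) p ->
  forall j, a j <= p j <= a j + phi^-1.
Proof.
move=> supp j; apply/negPn/negP => pj.
pose A (l : 'I_n) : set R := if l == j then ~` noise j else setT.
have openA l : open (A l).
  rewrite /A; case: ifP => _; last exact: openT.
  by apply: closed_openC; exact: interval_closed.
have pA l : A l (p l).
  rewrite /A; case: eqP => // ->; rewrite /noise /= in_itv /=; exact/negP.
have := supp A openA pA; rewrite /box_prob (bigD1 j) //= /law /=.
rewrite integral_uniform_density; last first.
  by apply: measurableI; [exact: measurable_itv | exact: open_measurable].
by rewrite /A eqxx setICA setICr setI0 measure0 mule0 mul0r ltxx.
Qed.

End UniformInstance.

(** * The machine classes and the one-job-per-machine assignment *)

Section MachineClasses.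
Variable K : nat.
Hypothesis K_gt0 : (0 < K)%N.

Let m := (K.+1 ^ K).-1.

Let m1E : m.+1 = (K.+1 ^ K)%N. Proof. by rewrite prednK // expn_gt0. Qed.

(* The first [K.+1 ^ (K - k)] machines are those of class at least [k]. *)
Definition machine_class (i : 'I_m.+1) : nat := K - up_log K.+1 i.+1.

Lemma machine_class_noninc (i i' : 'I_m.+1) :
  (i <= i')%N -> (machine_class i' <= machine_class i)%N.
Proof. by move=> ii'; rewrite leq_sub2l // leq_up_log. Qed.

Lemma machine_class_ord0 : machine_class ord0 = K.
Proof. by rewrite /machine_class up_log1 subn0. Qed.

Lemma machine_class_ord_max : machine_class ord_max = 0%N.
Proof.
apply/eqP; rewrite subn_eq0 /= m1E.
by have := @up_logP K.+1 (K.+1 ^ K) K_gt0; rewrite leq_exp2l.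
Qed.

Definition job_slot : finType :=
  {x : 'I_m.+1 * 'I_K | (x.2 < machine_class x.1)%N}.

Definition slot_machine (j : 'I_#|job_slot|) : 'I_m.+1 := (val (enum_val j)).1.
Definition slot_round (j : 'I_#|job_slot|) : nat := (val (enum_val j)).2.

Lemma slot_round_lt j : (slot_round j < machine_class (slot_machine j))%N.
Proof. exact: (valP (enum_val j)). Qed.

Lemma slot_inj j l :
  slot_machine j = slot_machine l -> slot_round j = slot_round l -> j = l.
Proof.
move=> jl /val_inj jl'; apply: enum_val_inj; apply: val_inj.
by rewrite [LHS]surjective_pairing [RHS]surjective_pairing; congr pair.
Qed.

Lemma slot_surj i r : (r < machine_class i)%N ->
  exists2 j, slot_machine j = i & slot_round j = r.
Proof.
move=> ri; have rK : (r < K)%N by rewrite (leq_trans ri) ?leq_subr.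
pose x : job_slot := exist _ (i, Ordinal rK) ri.
by exists (enum_rank x); rewrite /slot_machine /slot_round enum_rankK.
Qed.

(** Heap numbering with arity [K.+1]: the jobs of a machine go to its children. Machine and round
    are recovered as quotient and remainder by [K.+1], whence injectivity. *)
Definition spread (j : 'I_#|job_slot|) : 'I_m.+1 :=
  inord (K.+1 * slot_machine j + (slot_round j).+1).

Let slot_bound j :
  (K.+1 * slot_machine j + (slot_round j).+1 < K.+1 * (slot_machine j).+1)%N.
Proof.
have : (slot_round j < K)%N by exact: ltn_ord.
by rewrite mulnS addnC ltn_add2r ltnS.
Qed.

Let spread_bound j : (K.+1 * (slot_machine j).+1 <=
  K.+1 ^ (up_log K.+1 (slot_machine j).+1).+1)%N.
Proof. by rewrite expnS leq_mul2l up_logP ?orbT. Qed.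

Let spreadE j : spread j = K.+1 * slot_machine j + (slot_round j).+1 :> nat.
Proof.
rewrite inordK // [ltnRHS]m1E (leq_trans (slot_bound j)) //.
rewrite (leq_trans (spread_bound j)) //.
(* A machine that has a job is of class at least 1, so its children are still among the [K.+1 ^ K]
   machines. *)
have := slot_round_lt j; rewrite /machine_class => lt_cls.
by rewrite leq_exp2l // -subn_gt0 (leq_ltn_trans _ lt_cls).
Qed.

Lemma spread_inj : injective spread.
Proof.
move=> j l /(congr1 (@nat_of_ord _)); rewrite !spreadE.
have rK x : ((slot_round x).+1 < K.+1)%N by rewrite ltnS; exact: ltn_ord.
move=> jl; apply: slot_inj.
  apply: val_inj => /=; have := congr1 (divn^~ K.+1) jl.
  by rewrite /= ![K.+1 * _]mulnC !divnMDl // !divn_small // !addn0.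
have := congr1 (modn^~ K.+1) jl.
by rewrite /= ![K.+1 * _]mulnC !modnMDl !modn_small // => -[].
Qed.

(** Passing to a child multiplies the one-based index by at most [K.+1], so its [up_log] grows by at
    most one. *)
Lemma spread_class j :
  (machine_class (slot_machine j) <= (machine_class (spread j)).+1)%N.
Proof.
rewrite /machine_class spreadE.
suff : (up_log K.+1 (K.+1 * slot_machine j + (slot_round j).+1).+1 <=
        (up_log K.+1 (slot_machine j).+1).+1)%N.
  by move: (up_log _ _) (up_log _ _) => u v; lia.
by rewrite up_log_min // (leq_trans (slot_bound j)).
Qed.

End MachineClasses.

(** * Instances for small and large [phi], and the logarithmic bound *)

(** This serves [phi < 32], where a constant ratio suffices. At [phi = 1] the size may be 0 and the
    ratio then 0 by convention, which is harmless since [ln 1 = 0]. *)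
Lemma single_machine_instance (R : realType) (phi : R) : 1 <= phi ->
  exists I : smooth_instance phi,
  forall p : 'I_(njobs I) -> R, in_support p ->
    (phi = 1 \/ 1 <= worst_ratio (speed I) p (lex_jump_optimal (speed I) p)) /\
    (phi = 1 \/ 1 <= worst_ratio (speed I) p (list_schedule (speed I) p)).
Proof.
move=> phi1; have phi0 : 0 < phi by apply: lt_le_trans phi1.
(* The interval is placed as high as possible, making the size positive once [phi > 1]. *)
have a_range (j : 'I_1) : 0 <= 1 - phi^-1 <= 1 - phi^-1.
  by rewrite lexx subr_ge0 invf_le1 // phi1.
have noninc (i i' : 'I_1) : (i <= i')%N -> (1 : R) <= 1 by [].
exists (uniform_instance phi0 noninc erefl a_range) => p /uniform_support supp.
have [phiE|phi_neq1] := eqVneq phi 1; first by split; left.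
have phi_gt1 : 1 < phi by rewrite lt_neqAle eq_sym phi_neq1.
have p_gt0 j : 0 < p j.
  have /andP[+ _] := supp j; apply: lt_le_trans.
  by rewrite subr_gt0 invf_lt1.
pose s1 (_ : 'I_1) : R := 1.
have ratio1 (sigma : schedule 0 1) :
    1 <= Cmax s1 p sigma / Copt s1 p.
  rewrite ler_pdivlMr ?mul1r; first exact: Copt_le_Cmax.
  by apply: (@Copt_gt0 _ _ _ _ _ ord0) => // j; exact: ltW.
split; right; apply: (worst_ratio_ge (sigma := [ffun=> ord0])) => //.
  apply/forallP => i; apply/forallP => j; apply/implyP => _; apply/forallP => i'.
  by rewrite (ord1 i) (ord1 i') eqxx.
apply/existsP; exists 1%g; apply/forallP => k; apply/forallP => i.
by rewrite (ord1 i) (ord1 (_ (_ k))).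
Qed.

Lemma layered_instance (R : realType) (phi : R) (K : nat) :
  (0 < K)%N -> 32 ^+ K <= phi ->
  exists I : smooth_instance phi,
  forall p : 'I_(njobs I) -> R, in_support p ->
    K%:R / 3 <= worst_ratio (speed I) p (lex_jump_optimal (speed I) p) /\
    K%:R / 3 <= worst_ratio (speed I) p (list_schedule (speed I) p).
Proof.
move=> K_gt0 phi_ge.
have phi_gt0 : 0 < phi by apply: lt_le_trans phi_ge; rewrite exprn_gt0.
have d_gt0 : 0 < phi^-1 by rewrite invr_gt0.
pose cls := @machine_class K.
pose U : R := 8 ^+ K / phi.
have cls_le i : (cls i <= K)%N by exact: leq_subr.
have noninc (i i' : 'I_(K.+1 ^ K).-1.+1) :
    (i <= i')%N -> (2 : R) ^+ cls i' <= 2 ^+ cls i.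
  by move=> ii'; rewrite ler_weXn2l ?ler1n // machine_class_noninc.
have last1 : (2 : R) ^+ cls ord_max = 1.
  by rewrite /cls machine_class_ord_max.
have a_range (j : 'I_#|job_slot K|) :
    0 <= 2 ^+ cls (slot_machine j) * U <= 1 - phi^-1.
  rewrite mulr_ge0 ?divr_ge0 ?exprn_ge0 ?(ltW phi_gt0) //=.
  rewrite lerBrDr /U mulrA -[X in _ + X]mul1r -mulrDl.
  rewrite ler_pdivrMr // mul1r (le_trans _ phi_ge) //.
  (* The chain is [2 ^ cls * 8 ^ K + 1 <= 16 ^ K + 1 <= 2 * 16 ^ K <= 32 ^ K]. *)
  have le2 : 2 ^+ cls (slot_machine j) <= 2 ^+ K :> R.
    by rewrite ler_weXn2l ?ler1n.
  have : 2 ^+ cls (slot_machine j) * 8 ^+ K <= 16 ^+ K :> R.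
    have -> : 16 = 2 * 8 :> R by rewrite -natrM.
    by rewrite exprMn ler_pM2r ?exprn_gt0.
  have -> : 32 ^+ K = 2 ^+ K * 16 ^+ K :> R by rewrite -exprMn -natrM.
  have ge1 : 1 <= 16 ^+ K :> R by rewrite exprn_ege1 ?ler1n.
  move=> /lerD /(_ ge1) /le_trans; apply.
  rewrite -[X in X + _]mul1r -[X in _ + X]mul1r -mulrDl ler_pM2r ?exprn_gt0 //.
  by rewrite -mulr2n -natrX ler_nat (@leq_exp2l 2 1).
exists (uniform_instance phi_gt0 noninc last1 a_range) => p /uniform_support supp.
have K_lt : (K < 2 ^ K)%N by exact: ltn_expl.
have e_gt0 : 0 < K%:R * phi^-1 by rewrite mulr_gt0 ?ltr0n.
(* Times [phi], this is [(2 * K + 1) * K < 8 ^ K], the product of [2 * K + 1 <= 4 ^ K] and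
   [K < 2 ^ K]. *)
have e_small : (2 * K%:R + 1) * (K%:R * phi^-1) < U.
  rewrite mulrA ltr_pM2r // -natrM natr1 -natrM -natrX ltr_nat.
  have -> : (8 ^ K = 4 ^ K * 2 ^ K)%N by rewrite -expnMn.
  have K2_le : ((2 * K).+1 <= 4 ^ K)%N.
    rewrite (_ : 4 = 2 * 2)%N // expnMn (@leq_trans (2 * 2 ^ K)) //.
      by move: K_lt; lia.
    by rewrite leq_mul2r (@leq_exp2l 2 1) // K_gt0 orbT.
  apply: (@leq_ltn_trans (4 ^ K * K)); first by rewrite leq_mul2r K2_le orbT.
  by rewrite ltn_pmul2l // expn_gt0.
have e_le : 2 ^+ K * (K%:R * phi^-1) <= U.
  rewrite mulrA ler_pM2r // -!natrX -natrM ler_nat.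
  have -> : (8 ^ K = 2 ^ K * 4 ^ K)%N by rewrite -expnMn.
  rewrite leq_mul2l (leq_trans (ltnW K_lt)) ?orbT //.
  by rewrite leq_exp2r.
have ratio := layered_ratio cls_le (@slot_round_lt K) (@slot_inj K)
  (@slot_surj K) supp d_gt0 (lexx _) e_gt0 e_small e_le
  (@spread_inj K K_gt0) (@spread_class K K_gt0) (machine_class_ord0 K) K_gt0.
split; apply: worst_ratio_ge ratio.
  exact: (layered_lex_jump_optimal cls_le (@slot_round_lt K) (@slot_inj K)
    (@slot_surj K) supp d_gt0 (lexx _) e_gt0 e_small e_le).
exact: (layered_list_schedule cls_le (@slot_round_lt K) (@slot_inj K)
  (@slot_surj K) supp d_gt0 (lexx _) e_gt0 e_small e_le).
Qed.

Theorem theorem17 (R : realType) :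
  exists c : R, 0 < c /\
    forall phi : R, 1 <= phi ->
    exists I : smooth_instance phi,
    forall p : 'I_(njobs I) -> R, in_support p ->
      worst_ratio (speed I) p (lex_jump_optimal (speed I) p)
        >= c * ln phi /\
      worst_ratio (speed I) p (list_schedule (speed I) p)
        >= c * ln phi.
Proof.
have ln32 : 0 < ln (32 : R) by rewrite ln_gt0 // ltr1n.
(* For [32 ^ K <= phi < 32 ^ (K + 1)] with [K >= 1], [ln phi <= (K + 1) * ln 32 <= 2 * K * ln 32],
   and the ratio is at least [K / 3]. *)
exists (6 * ln 32)^-1; split; first by rewrite invr_gt0 mulr_gt0.
move=> phi phi1; have phi0 : 0 < phi by apply: lt_le_trans phi1.
have bound (x : R) : ln phi <= 6 * ln 32 * x -> (6 * ln 32)^-1 * ln phi <= x.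
  by move=> ?; rewrite ler_pdivrMl // mulr_gt0.
have [phi32|phi32] := leP 32 phi; last first.
  have [I supp] := single_machine_instance phi1.
  exists I => p /supp[lexP listP].
  have ge_ratio (x : R) : 0 <= x -> phi = 1 \/ 1 <= x ->
      (6 * ln 32)^-1 * ln phi <= x.
    move=> x0 [->|x1]; first by rewrite ln1 mulr0.
    apply: bound.
    have : ln phi <= ln 32 by rewrite ler_ln ?posrE // ltW.
    have : ln 32 * 1 <= ln 32 * x by rewrite ler_pM2l.
    lra.
  by split; apply: ge_ratio => //; exact: worst_ratio_ge0.
pose K := trunc_log 32 (Num.trunc phi).
have trunc32 : (32 <= Num.trunc phi)%N by rewrite truncn_ge_nat // ltW.
have K_gt0 : (0 < K)%N by rewrite trunc_log_gt0.
have phi_ge : 32 ^+ K <= phi.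
  rewrite -natrX -truncn_ge_nat ?ltW // trunc_logP //.
  exact: leq_trans trunc32.
have [I supp] := layered_instance K_gt0 phi_ge.
exists I => p /supp[lexP listP].
suff K_bound : (6 * ln 32)^-1 * ln phi <= K%:R / 3.
  by split; apply: le_trans K_bound _.
apply: bound.
have : ln phi <= ln (32 ^+ K.+1).
  rewrite ler_ln ?posrE ?exprn_gt0 // ltW // -natrX -truncn_lt_nat ?ltW //.
  exact: trunc_log_ltn.
rewrite lnXn // -[ln 32 *+ _]mulr_natr -[K.+1%:R]natr1.
have : ln 32 * 1 <= ln 32 * K%:R :> R by rewrite ler_pM2l // ler1n.
lra.
Qed.
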